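(* Let $I\subset\mathbb{R}$ be an interval and let $(\boldsymbol{\gamma},\boldsymbol{\nu}_1,\boldsymbol{\nu}_2):I\to\mathbb{R}^3\times\Delta$ be a framed curve with a Bishop frame $\{\boldsymbol{v},\boldsymbol{w},\boldsymbol{\mu}\}$; let $(0,\overline{m},\overline{n},\alpha)$ be the curvature of $(\boldsymbol{\gamma},\boldsymbol{v},\boldsymbol{w})$ and assume $\overline{m}(t)\neq0$ for all $t\in I$. Let $t_0\in I$. Then the $t_0$-involute of the $\boldsymbol{v}$-evolute of $\boldsymbol{\gamma}$ satisfies, for all $t\in I$, $$I_{E_{\boldsymbol{\gamma}}[\boldsymbol{v}]}[t_0](t)=\boldsymbol{\gamma}(t)-\frac{\alpha(t_0)}{\overline{m}(t_0)}\boldsymbol{v}(t)=P_{\boldsymbol{\gamma}}[\boldsymbol{v}](t),$$ where $P_{\boldsymbol{\gamma}}[\boldsymbol{v}](t)=\boldsymbol{\gamma}(t)+\lambda\boldsymbol{v}(t)$ with $\lambda=-\alpha(t_0)/\overline{m}(t_0)$.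
   Context: All maps are of class $C^\infty$. $S^2$ is the unit sphere in Euclidean space $\mathbb{R}^3$ and $\Delta=\{(\boldsymbol{x},\boldsymbol{y})\in S^2\times S^2\mid \boldsymbol{x}\cdot\boldsymbol{y}=0\}$. Framed curve: a smooth map $(\boldsymbol{\gamma},\boldsymbol{\nu}_1,\boldsymbol{\nu}_2):I\to\mathbb{R}^3\times\Delta$ with $\dot{\boldsymbol{\gamma}}\cdot\boldsymbol{\nu}_1=\dot{\boldsymbol{\gamma}}\cdot\boldsymbol{\nu}_2=0$ on $I$. Its unit tangent vector is $\boldsymbol{\mu}=\boldsymbol{\nu}_1\times\boldsymbol{\nu}_2$, and its curvature is $(\ell,m,n,\alpha)$ with $\ell=\dot{\boldsymbol{\nu}}_1\cdot\boldsymbol{\nu}_2$, $m=\dot{\boldsymbol{\nu}}_1\cdot\boldsymbol{\mu}$, $n=\dot{\boldsymbol{\nu}}_2\cdot\boldsymbol{\mu}$, $\alpha=\dot{\boldsymbol{\gamma}}\cdot\boldsymbol{\mu}$. Bishop frame: for a smooth function $\theta:I\to\mathbb{R}$ with $\dot\theta=\ell$, put $\boldsymbol{v}=\cos\theta\,\boldsymbol{\nu}_1-\sin\theta\,\boldsymbol{\nu}_2$ and $\boldsymbol{w}=\sin\theta\,\boldsymbol{\nu}_1+\cos\theta\,\boldsymbol{\nu}_2$. Then $(\boldsymbol{\gamma},\boldsymbol{v},\boldsymbol{w})$ is a framed curve with unit tangent vector $\boldsymbol{v}\times\boldsymbol{w}=\boldsymbol{\mu}$ and $\dot{\boldsymbol{\gamma}}=\alpha\boldsymbol{\mu}$,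 $\dot{\boldsymbol{v}}=\overline{m}\boldsymbol{\mu}$, $\dot{\boldsymbol{w}}=\overline{n}\boldsymbol{\mu}$, $\dot{\boldsymbol{\mu}}=-\overline{m}\boldsymbol{v}-\overline{n}\boldsymbol{w}$; $\{\boldsymbol{v},\boldsymbol{w},\boldsymbol{\mu}\}$ is called a Bishop frame along $\boldsymbol{\gamma}$. Circular evolute: when $\overline{m}$ is nowhere zero, the $\boldsymbol{v}$-evolute is $E_{\boldsymbol{\gamma}}[\boldsymbol{v}](t)=\boldsymbol{\gamma}(t)-\frac{\alpha(t)}{\overline{m}(t)}\boldsymbol{v}(t)$. It is regarded as a framed curve $(E_{\boldsymbol{\gamma}}[\boldsymbol{v}],\boldsymbol{v}_E,\boldsymbol{w}_E)$, where $\boldsymbol{v}_E=\cos\theta_E\,\boldsymbol{w}-\sin\theta_E\,\boldsymbol{\mu}$, $\boldsymbol{w}_E=\sin\theta_E\,\boldsymbol{w}+\cos\theta_E\,\boldsymbol{\mu}$ and $\theta_E$ is a smooth function with $\dot\theta_E=\overline{n}$. Its unit tangent vector is $\boldsymbol{v}_E\times\boldsymbol{w}_E=\boldsymbol{v}$. Involute: for any framed curve with unit tangent vector $\boldsymbol{\mu}$ and curvature $(\ell,m,n,\alpha)$ with $m^2+n^2$ nowhere zero, and $t_0\in I$, the $t_0$-involute is $I_{\boldsymbol{\gamma}}[t_0](t)=\boldsymbol{\gamma}(t)-\left(\int_{t_0}^t\alpha(\tau)\,d\tau\right)\boldsymbol{\mu}(t)$. For the framed curve $E_{\boldsymbol{\gamma}}[\boldsymbol{v}]$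 this reads $I_{E_{\boldsymbol{\gamma}}[\boldsymbol{v}]}[t_0](t)=E_{\boldsymbol{\gamma}}[\boldsymbol{v}](t)-\left(\int_{t_0}^t\alpha_E(\tau)\,d\tau\right)\boldsymbol{v}(t)$ with $\alpha_E=\dot{E}_{\boldsymbol{\gamma}}[\boldsymbol{v}]\cdot\boldsymbol{v}$. *)

(* Defs.v *)
From Stdlib Require Import Reals.
From Coquelicot Require Import Coquelicot.
Open Scope R_scope.

(* Endpoints may or may not belong to the interval; single points are
   excluded, so that derivatives on the interval are unique. *)
Definition is_interval (I : R -> Prop) : Prop :=
  (forall a b x, I a -> I b -> a <= x <= b -> I x) /\
  (exists a b, I a /\ I b /\ a < b).

(* Derivatives are taken along [I]: the usual derivative at interior points,
   the one-sided derivative at an endpoint that belongs to [I].  The value of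
   [Derive_on I f t] is meaningful only for [t] in [I] where [f] is
   differentiable. *)
Definition is_derive_on (I : R -> Prop) (f : R -> R) (t l : R) : Prop :=
  filterdiff f (within I (locally t)) (fun h => scal h l).

Definition Derive_on (I : R -> Prop) (f : R -> R) (t : R) : R :=
  iota (is_derive_on I f t).

Fixpoint Derive_n_on (I : R -> Prop) (f : R -> R) (k : nat) : R -> R :=
  match k with
  | O => f
  | S k => Derive_on I (Derive_n_on I f k)
  end.

Definition smooth_on (I : R -> Prop) (f : R -> R) : Prop :=
  forall (k : nat) (t : R), I t ->
    exists l, is_derive_on I (Derive_n_on I f k) t l.

(* Sums and multiples in R^3 are Coquelicot's [plus], [minus], [scal] on the
   product module. *)
Notation R3 := (R * R * R)%type.

Definition cx (x : R3) : R := fst (fst x).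
Definition cy (x : R3) : R := snd (fst x).
Definition cz (x : R3) : R := snd x.

Definition dot (x y : R3) : R := cx x * cx y + cy x * cy y + cz x * cz y.

Definition cross (x y : R3) : R3 :=
  (cy x * cz y - cz x * cy y,
   cz x * cx y - cx x * cz y,
   cx x * cy y - cy x * cx y).

Definition smooth_on3 (I : R -> Prop) (f : R -> R3) : Prop :=
  smooth_on I (fun t => cx (f t)) /\
  smooth_on I (fun t => cy (f t)) /\
  smooth_on I (fun t => cz (f t)).

Definition Derive_on3 (I : R -> Prop) (f : R -> R3) (t : R) : R3 :=
  (Derive_on I (fun s => cx (f s)) t,
   Derive_on I (fun s => cy (f s)) t,
   Derive_on I (fun s => cz (f s)) t).

Definition S2 (x : R3) : Prop := dot x x = 1.

Definition Delta (x y : R3) : Prop := S2 x /\ S2 y /\ dot x y = 0.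

Record framed_map : Type := FramedMap {
  gamma : R -> R3;
  nu1 : R -> R3;
  nu2 : R -> R3
}.

Definition framed_curve (I : R -> Prop) (F : framed_map) : Prop :=
  smooth_on3 I (gamma F) /\ smooth_on3 I (nu1 F) /\ smooth_on3 I (nu2 F) /\
  (forall t, I t ->
     Delta (nu1 F t) (nu2 F t) /\
     dot (Derive_on3 I (gamma F) t) (nu1 F t) = 0 /\
     dot (Derive_on3 I (gamma F) t) (nu2 F t) = 0).

Definition mu (F : framed_map) (t : R) : R3 := cross (nu1 F t) (nu2 F t).

Definition curv_l (I : R -> Prop) (F : framed_map) (t : R) : R :=
  dot (Derive_on3 I (nu1 F) t) (nu2 F t).
Definition curv_m (I : R -> Prop) (F : framed_map) (t : R) : R :=
  dot (Derive_on3 I (nu1 F) t) (mu F t).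
Definition curv_n (I : R -> Prop) (F : framed_map) (t : R) : R :=
  dot (Derive_on3 I (nu2 F) t) (mu F t).
Definition curv_alpha (I : R -> Prop) (F : framed_map) (t : R) : R :=
  dot (Derive_on3 I (gamma F) t) (mu F t).

Definition bishop_angle (I : R -> Prop) (F : framed_map) (theta : R -> R)
    : Prop :=
  smooth_on I theta /\ (forall t, I t -> Derive_on I theta t = curv_l I F t).

(* The triple (gamma, v, w). *)
Definition bishop (F : framed_map) (theta : R -> R) : framed_map :=
  FramedMap (gamma F)
    (fun t => minus (scal (cos (theta t)) (nu1 F t))
                    (scal (sin (theta t)) (nu2 F t)))
    (fun t => plus (scal (sin (theta t)) (nu1 F t))
                   (scal (cos (theta t)) (nu2 F t))).

(* From here on [B] stands for a triple (gamma, v, w) given by a Bishop frame,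
   so that [nu1 B], [nu2 B], [mu B] are v, w, mu. *)
Definition evolute_angle (I : R -> Prop) (B : framed_map) (thetaE : R -> R)
    : Prop :=
  smooth_on I thetaE /\ (forall t, I t -> Derive_on I thetaE t = curv_n I B t).

(* The triple (E_gamma[v], v_E, w_E). *)
Definition v_evolute (I : R -> Prop) (B : framed_map) (thetaE : R -> R)
    : framed_map :=
  FramedMap
    (fun t => minus (gamma B t)
                    (scal (curv_alpha I B t / curv_m I B t) (nu1 B t)))
    (fun t => minus (scal (cos (thetaE t)) (nu2 B t))
                    (scal (sin (thetaE t)) (mu B t)))
    (fun t => plus (scal (sin (thetaE t)) (nu2 B t))
                   (scal (cos (thetaE t)) (mu B t))).

(* [RInt] is oriented, so [t] may lie on either side of [t0]. *)
Definition involute (I : R -> Prop) (F : framed_map) (t0 t : R) : R3 :=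
  minus (gamma F t) (scal (RInt (curv_alpha I F) t0 t) (mu F t)).

Definition v_parallel (B : framed_map) (lambda : R) (t : R) : R3 :=
  plus (gamma B t) (scal lambda (nu1 B t)).

(* Main.v *)
Require Import Defs.
From Stdlib Require Import Reals Lra.
From Coquelicot Require Import Coquelicot.
Open Scope R_scope.

(** The evolute moves only along [v].  Write [g = alpha / m], so that
    [E = gamma - g v].  The tangent vector of the evolute is
    [v_E x w_E = w x mu = v]: turning an orthonormal pair in its plane does not
    change its cross product.  Hence
    [alpha_E = E' . v = gamma' . v - g' (v . v) - g (v' . v)].
    Here [gamma' . v = 0] because [gamma'] is orthogonal to both [nu1] and
    [nu2], whose span contains [v]; and [v' . v = 0] because [v] has constant
    length.  So [alpha_E = - g'] ([evolute_alpha]), the integral of [alpha_E]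
    from [t0] to [t] is [g t0 - g t], and the involute
    [gamma - g(t) v - (g t0 - g t) v] is [gamma - g(t0) v].

    The analytic content is that the fundamental theorem of calculus may be
    applied to [g] on an arbitrary interval [I], whose endpoints may belong to
    it and where derivatives are then one-sided.  This is
    [RInt_derive_on]; it asks that [g] be of class C^1 along [I].  That
    regularity comes from the closure properties of the classes [Ck_on]:
    [alpha] and [m] involve one derivative of [gamma] and [v], so they keep as
    many derivatives as needed. *)

(** * Derivatives along an interval *)

Lemma within_locally_proper (I : R -> Prop) (t : R) :
  I t -> ProperFilter (within I (locally t)).
Proof.
  intros It; split.
  - intros P HP.
    exists t; exact (locally_singleton _ _ HP It).
  - apply within_filter, locally_filter.
Qed.

Lemma within_locally_lim (I : R -> Prop) (t : R) :
  is_filter_lim (within I (locally t)) t.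
Proof. intros P HP; exact (filter_le_within I P HP). Qed.

(** Two derivatives at [t] differ by at most any [eps], as seen from a single
    point of [I] near [t] but distinct from it; a nondegenerate interval has
    such points. *)
Lemma is_derive_on_unique (I : R -> Prop) (f : R -> R) (t l1 l2 : R) :
  is_interval I -> I t ->
  is_derive_on I f t l1 -> is_derive_on I f t l2 -> l1 = l2.
Proof.
  intros [conv [a [b [Ia [Ib ab]]]]] It [_ H1] [_ H2].
  apply cond_eq; intros eps Heps.
  assert (He : 0 < eps / 4) by lra.
  pose proof (within_locally_lim I t) as Hl.
  destruct (filter_and (F := locally t) _ _
              (H1 t Hl (mkposreal _ He)) (H2 t Hl (mkposreal _ He)))
    as [d Hd].
  assert (Hy : exists y, I y /\ y <> t /\ Rabs (y - t) < d).
  { destruct d as [d dpos]; simpl.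
    destruct (Rlt_dec t b) as [tb | tb].
    - exists (Rmin b (t + d / 2)).
      assert (t < Rmin b (t + d / 2)) by (apply Rmin_glb_lt; lra).
      pose proof (Rmin_l b (t + d / 2)); pose proof (Rmin_r b (t + d / 2)).
      split; [apply (conv t b); [assumption | assumption | lra] |].
      split; [lra | rewrite Rabs_right; lra].
    - exists (Rmax a (t - d / 2)).
      assert (Rmax a (t - d / 2) < t) by (apply Rmax_lub_lt; lra).
      pose proof (Rmax_l a (t - d / 2)); pose proof (Rmax_r a (t - d / 2)).
      split; [apply (conv a t); [assumption | assumption | lra] |].
      split; [lra | rewrite Rabs_left; lra]. }
  destruct Hy as [y [Iy [yt yd]]].
  destruct (Hd y yd) as [B1 B2].
  specialize (B1 Iy); specialize (B2 Iy).
  unfold norm, minus, plus, opp, scal, mult in B1, B2; simpl in B1, B2.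
  unfold abs, mult in B1, B2; simpl in B1, B2.
  assert (P : 0 < Rabs (y - t)) by (apply Rabs_pos_lt; lra).
  apply (Rmult_lt_reg_r (Rabs (y - t))); [exact P |].
  rewrite <- Rabs_mult.
  replace ((l1 - l2) * (y - t)) with
    ((f y + - f t + - ((y + - t) * l2)) - (f y + - f t + - ((y + - t) * l1)))
    by ring.
  eapply Rle_lt_trans; [apply Rabs_triang |].
  rewrite Rabs_Ropp.
  unfold Rminus in P |- *.
  nra.
Qed.

Lemma Derive_on_eq (I : R -> Prop) (f : R -> R) (t l : R) :
  is_interval I -> I t -> is_derive_on I f t l -> Derive_on I f t = l.
Proof.
  intros hI It Hf.
  apply (iota_unique (V := R_CompleteNormedModule)); [| exact Hf].
  intros y Hy; exact (is_derive_on_unique I f t y l hI It Hy Hf).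
Qed.

Lemma is_derive_on_ext (I : R -> Prop) (f g : R -> R) (t l : R) :
  I t -> (forall s, I s -> f s = g s) ->
  is_derive_on I f t l -> is_derive_on I g t l.
Proof.
  intros It E; pose proof (within_locally_proper I t It) as PF.
  apply filterdiff_ext_loc.
  - exact (filter_forall (F := locally t) _ E).
  - intros x Hx.
    replace x with t; [exact (E t It) |].
    exact (is_filter_lim_unique (V := R_NormedModule) _ _
             (within_locally_lim I t) Hx).
Qed.

Lemma is_derive_on_continuous (I : R -> Prop) (f : R -> R) (t l : R) :
  is_derive_on I f t l ->
  filterlim f (within I (locally t)) (locally (f t)).
Proof.
  intros Hf.
  apply (filterdiff_continuous_aux (U := R_NormedModule) (V := R_NormedModule)).
  - eexists; exact Hf.
  - apply within_locally_lim.
Qed.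

Lemma is_derive_on_const (I : R -> Prop) (c t : R) :
  is_derive_on I (fun _ => c) t 0.
Proof.
  apply (filterdiff_ext_lin _ (fun _ => zero)).
  - apply filterdiff_const.
  - intros y; symmetry; apply Rmult_0_r.
Qed.

Lemma is_derive_on_plus (I : R -> Prop) (f g : R -> R) (t f' g' : R) :
  is_derive_on I f t f' -> is_derive_on I g t g' ->
  is_derive_on I (fun s => f s + g s) t (f' + g').
Proof.
  intros Hf Hg.
  refine (filterdiff_ext_lin _ _ _ (filterdiff_plus_fct _ _ _ _ Hf Hg) _).
  intros y; symmetry; apply Rmult_plus_distr_l.
Qed.

Lemma is_derive_on_mult (I : R -> Prop) (f g : R -> R) (t f' g' : R) :
  I t -> is_derive_on I f t f' -> is_derive_on I g t g' ->
  is_derive_on I (fun s => f s * g s) t (f' * g t + f t * g').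
Proof.
  intros It Hf Hg.
  pose proof (within_locally_proper I t It) as PF.
  pose proof (filterlim_pair _ _ (is_derive_on_continuous I f t f' Hf)
                (is_derive_on_continuous I g t g' Hg)) as Hlim.
  refine (filterdiff_ext_lin _ _ _
    (filterdiff_comp_2 (K := R_AbsRing) (T := R_NormedModule)
       (U := AbsRing_NormedModule R_AbsRing)
       (V := AbsRing_NormedModule R_AbsRing)
       (W := AbsRing_NormedModule R_AbsRing)
       f g Rmult _ _ (fun x y => x * g t + f t * y) Hf Hg _) _).
  - refine (@filterdiff_mult R_AbsRing
      (filtermap (fun s => (f s, g s)) (within I (locally t)))
      _ (f t, g t) _ Rmult_comm).
    intros P [d Hd]; apply Hlim.
    exists (fun x => ball (f t) d x) (fun y => ball (g t) d y);
      [apply locally_ball | apply locally_ball |].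
    intros x y Hx Hy; apply Hd; split; assumption.
  - intros y; unfold scal; simpl; unfold mult; simpl; ring.
Qed.

Lemma is_derive_on_opp (I : R -> Prop) (f : R -> R) (t f' : R) :
  is_derive_on I f t f' -> is_derive_on I (fun s => - f s) t (- f').
Proof.
  intros Hf.
  refine (filterdiff_ext_lin _ _ _ (filterdiff_opp_fct _ _ Hf) _).
  intros y; symmetry; apply Ropp_mult_distr_r_reverse.
Qed.

Lemma is_derive_on_comp (I : R -> Prop) (f g : R -> R) (t f' g' : R) :
  I t -> is_derive g (f t) g' -> is_derive_on I f t f' ->
  is_derive_on I (fun s => g (f s)) t (g' * f').
Proof.
  intros It Hg Hf.
  pose proof (within_locally_proper I t It) as PF.
  refine (filterdiff_ext_lin _ _ _
    (filterdiff_comp f g _ (fun y => scal y g') Hf _) _).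
  - apply (filterdiff_locally (U := R_NormedModule) g (f t)); [| exact Hg].
    intros P; apply (is_derive_on_continuous I f t f' Hf).
  - intros y; unfold scal; simpl; unfold mult; simpl; ring.
Qed.

(** Away from the endpoints of [I], small neighbourhoods of [t] lie in [I], so
    restricting to [I] changes nothing. *)
Lemma is_derive_on_interior (I : R -> Prop) (f : R -> R) (t l : R) :
  locally t I -> is_derive_on I f t l -> is_derive f t l.
Proof.
  intros It [Hlin Hf]; split; [exact Hlin |].
  intros x Hx eps.
  replace x with t in *;
    [| exact (is_filter_lim_locally_unique (V := R_NormedModule) _ _ Hx)].
  generalize (filter_and _ _ It (Hf t (within_locally_lim I t) eps)).
  apply filter_imp; intros y [Iy Hy]; exact (Hy Iy).
Qed.

(** The usual theorem wants two-sided hypotheses at [a] and [b], where [h] and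
    [g] are only controlled from within [I].  Precomposing both with the
    retraction of the line onto the segment between [a] and [b] makes them
    continuous everywhere, and the mean value theorem needs derivatives only
    inside the segment. *)
Lemma RInt_derive_on (I : R -> Prop) (g h : R -> R) (a b : R) :
  is_interval I -> (forall t, I t -> is_derive_on I g t (h t)) ->
  continuous_on I h -> I a -> I b -> RInt h a b = g b - g a.
Proof.
  intros [conv _] Hg Hh Ia Ib.
  set (lo := Rmin a b); set (hi := Rmax a b).
  set (c := fun x => Rmax lo (Rmin hi x)).
  assert (lohi : lo <= hi) by apply Rminmax.
  assert (cI : forall x, I (c x)).
  { intros x.
    assert (S : lo <= c x <= hi).
    { split; [apply Rmax_l |].
      apply Rmax_lub; [exact lohi | apply Rmin_l]. }
    revert S; unfold lo, hi.
    destruct (Rle_dec a b).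
    - rewrite Rmin_left, Rmax_right by lra; intros S; now apply (conv a b).
    - rewrite Rmin_right, Rmax_left by lra; intros S; now apply (conv b a). }
  assert (cid : forall x, lo <= x <= hi -> c x = x).
  { intros x Hx; unfold c.
    rewrite (Rmin_right hi x), Rmax_right; lra. }
  assert (cc : forall x, filterlim c (locally x) (within I (locally (c x)))).
  { intros x P [d Hd]; exists d; intros y Hy.
    apply Hd; [| apply cI].
    change (Rabs (c y - c x) < d); change (Rabs (y - x) < d) in Hy.
    apply Rle_lt_trans with (2 := Hy).
    unfold c, Rmax, Rmin, Rabs.
    repeat destruct Rle_dec; repeat destruct Rcase_abs; lra. }
  assert (hc : forall x, continuous (fun y => h (c y)) x).
  { intros x; exact (filterlim_comp _ _ _ _ _ _ _ _ (cc x) (Hh _ (cI x))). }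
  assert (gc : forall x, continuous (fun y => g (c y)) x).
  { intros x; refine (filterlim_comp _ _ _ _ _ _ _ _ (cc x) _).
    exact (is_derive_on_continuous _ _ _ _ (Hg _ (cI x))). }
  set (G := fun x => RInt (fun y => h (c y)) a x).
  assert (dG : forall x, is_derive G x (h (c x))).
  { intros x; apply (is_derive_RInt (fun y => h (c y)) G a x); [| apply hc].
    apply filter_forall; intros y.
    apply (RInt_correct (V := R_CompleteNormedModule)).
    apply (ex_RInt_continuous (V := R_CompleteNormedModule)); intros; apply hc. }
  assert (ab : lo <= a <= hi /\ lo <= b <= hi).
  { unfold lo, hi; repeat split;
      auto using Rmin_l, Rmin_r, Rmax_l, Rmax_r. }
  destruct (MVT_gen (fun x => G x - g (c x)) a b (fun _ => 0)) as [z [_ Hz]].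
  - intros x Hx; fold lo hi in Hx.
    assert (L : locally x (fun y => lo < y < hi))
      by (apply (open_and _ _ (open_gt lo) (open_lt hi)); exact Hx).
    assert (dg : is_derive (fun y => g (c y)) x (h x)).
    { apply (is_derive_ext_loc g).
      - revert L; apply filter_imp; intros y Hy; rewrite cid; [easy | lra].
      - apply (is_derive_on_interior I).
        + revert L; apply filter_imp; intros y Hy.
          rewrite <- (cid y) by lra; apply cI.
        + apply Hg; rewrite <- (cid x) by lra; apply cI. }
    replace 0 with (minus (h (c x)) (h x)).
    + apply (is_derive_minus (V := R_NormedModule) G); [apply dG | exact dg].
    + rewrite (cid x) by lra; apply Rplus_opp_r.
  - intros x _.
    apply continuity_pt_filterlim.
    apply (continuous_minus (V := R_NormedModule) G (fun y => g (c y))); [| apply gc].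
    apply (ex_derive_continuous (V := R_NormedModule)); eexists; apply dG.
  - rewrite (cid a), (cid b), Rmult_0_l in Hz by tauto.
    assert (Ga : G a = 0) by apply (RInt_point (V := R_CompleteNormedModule)).
    replace (RInt h a b) with (G b); [lra |].
    apply RInt_ext; intros x Hx; fold lo hi in Hx.
    rewrite cid; [easy | lra].
Qed.

(** * Functions of class C^k along an interval *)

Fixpoint Ck_on (I : R -> Prop) (k : nat) (f : R -> R) : Prop :=
  match k with
  | O => continuous_on I f
  | S k => exists f', (forall t, I t -> is_derive_on I f t (f' t)) /\
                      Ck_on I k f'
  end.

Lemma Ck_on_continuous (I : R -> Prop) (k : nat) (f : R -> R) :
  Ck_on I k f -> continuous_on I f.
Proof.
  destruct k as [| k]; [easy |].
  intros [f' [Hf _]] t It.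
  exact (is_derive_on_continuous _ _ _ _ (Hf t It)).
Qed.

Lemma Ck_on_weaken (I : R -> Prop) (k : nat) :
  forall f, Ck_on I (S k) f -> Ck_on I k f.
Proof.
  induction k as [| k IH]; intros f Hf.
  - exact (Ck_on_continuous I 1 f Hf).
  - destruct Hf as [f' [Hf Hf']].
    exists f'; split; [exact Hf | exact (IH f' Hf')].
Qed.

Lemma Ck_on_ext (I : R -> Prop) (k : nat) (f g : R -> R) :
  (forall s, I s -> f s = g s) -> Ck_on I k f -> Ck_on I k g.
Proof.
  intros E; destruct k as [| k].
  - exact (continuous_on_ext I f g E).
  - intros [f' [Hf Hf']]; exists f'; split; [| exact Hf'].
    intros t It; apply (is_derive_on_ext I f); auto.
Qed.

Lemma Derive_on_correct (I : R -> Prop) (k : nat) (f : R -> R) (t : R) :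
  is_interval I -> Ck_on I (S k) f -> I t ->
  is_derive_on I f t (Derive_on I f t).
Proof.
  intros hI [f' [Hf _]] It.
  rewrite (Derive_on_eq I f t (f' t)); auto.
Qed.

Lemma Ck_on_Derive_on (I : R -> Prop) (k : nat) (f : R -> R) :
  is_interval I -> Ck_on I (S k) f -> Ck_on I k (Derive_on I f).
Proof.
  intros hI [f' [Hf Hf']].
  apply (Ck_on_ext I k f'); [| exact Hf'].
  intros s Is; symmetry; apply Derive_on_eq; auto.
Qed.

(** The induction on [k] passes to the derivative, hence the claim for all the
    iterated derivatives of [f] at once. *)
Lemma smooth_on_Ck (I : R -> Prop) (f : R -> R) (k : nat) :
  is_interval I -> smooth_on I f -> Ck_on I k f.
Proof.
  intros hI Hf.
  enough (H : forall j, Ck_on I k (Derive_n_on I f j)) by exact (H O).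
  induction k as [| k IH]; intros j.
  - intros t It; destruct (Hf j t It) as [l Hl].
    exact (is_derive_on_continuous _ _ _ _ Hl).
  - exists (Derive_n_on I f (S j)); split; [| apply IH].
    intros t It; destruct (Hf j t It) as [l Hl]; simpl.
    rewrite (Derive_on_eq _ _ _ _ hI It Hl); exact Hl.
Qed.

Lemma Ck_on_const (I : R -> Prop) (k : nat) :
  forall c : R, Ck_on I k (fun _ => c).
Proof.
  induction k as [| k IH]; intros c.
  - intros t _; apply filterlim_const.
  - exists (fun _ => 0); split; [| apply IH].
    intros t _; apply is_derive_on_const.
Qed.

Lemma Ck_on_plus (I : R -> Prop) (k : nat) :
  forall f g, Ck_on I k f -> Ck_on I k g -> Ck_on I k (fun t => f t + g t).
Proof.
  induction k as [| k IH]; intros f g Hf Hg.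
  - intros t It.
    exact (filterlim_comp_2 f g Rplus (Hf t It) (Hg t It)
             (filterlim_plus (V := R_NormedModule) (f t) (g t))).
  - destruct Hf as [f' [Hf Hf']], Hg as [g' [Hg Hg']].
    exists (fun t => f' t + g' t); split; [| now apply IH].
    intros t It; apply is_derive_on_plus; auto.
Qed.

Lemma Ck_on_mult (I : R -> Prop) (k : nat) :
  forall f g, Ck_on I k f -> Ck_on I k g -> Ck_on I k (fun t => f t * g t).
Proof.
  induction k as [| k IH]; intros f g Hf Hg.
  - intros t It.
    exact (filterlim_comp_2 f g Rmult (Hf t It) (Hg t It)
             (filterlim_mult (K := R_AbsRing) (f t) (g t))).
  - pose proof (Ck_on_weaken I k f Hf) as Wf.
    pose proof (Ck_on_weaken I k g Hg) as Wg.
    destruct Hf as [f' [Hf Hf']], Hg as [g' [Hg Hg']].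
    exists (fun t => f' t * g t + f t * g' t); split.
    + intros t It; apply is_derive_on_mult; auto.
    + apply Ck_on_plus; now apply IH.
Qed.

Lemma Ck_on_opp (I : R -> Prop) (k : nat) (f : R -> R) :
  Ck_on I k f -> Ck_on I k (fun t => - f t).
Proof.
  intros Hf; apply (Ck_on_ext I k (fun t => -1 * f t)).
  - intros s _; ring.
  - apply Ck_on_mult; [apply Ck_on_const | exact Hf].
Qed.

Lemma Ck_on_minus (I : R -> Prop) (k : nat) (f g : R -> R) :
  Ck_on I k f -> Ck_on I k g -> Ck_on I k (fun t => f t - g t).
Proof.
  intros Hf Hg; apply Ck_on_plus; [exact Hf | now apply Ck_on_opp].
Qed.

Lemma Ck_on_inv (I : R -> Prop) (k : nat) (f : R -> R) :
  (forall t, I t -> f t <> 0) -> Ck_on I k f -> Ck_on I k (fun t => / f t).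
Proof.
  intros nz; induction k as [| k IH]; intros Hf.
  - intros t It.
    exact (filterlim_comp _ _ _ f Rinv _ _ _ (Hf t It)
             (continuous_Rinv (f t) (nz t It))).
  - pose proof (IH (Ck_on_weaken I k f Hf)) as Wi.
    destruct Hf as [f' [Hf Hf']].
    exists (fun t => - (/ f t * / f t) * f' t); split.
    + intros t It; apply is_derive_on_comp; auto.
      apply (is_derive_ext (fun x => / x)); [easy |].
      auto_derive; [exact (nz t It) | field; exact (nz t It)].
    + apply Ck_on_mult; [| exact Hf'].
      apply Ck_on_opp, Ck_on_mult; exact Wi.
Qed.

(** The two functions are each other's derivative up to sign, so neither
    induction can be run alone. *)
Lemma Ck_on_cos_sin (I : R -> Prop) (k : nat) (f : R -> R) :
  Ck_on I k f ->
  Ck_on I k (fun t => cos (f t)) /\ Ck_on I k (fun t => sin (f t)).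
Proof.
  induction k as [| k IH]; intros Hf.
  - split; intros t It.
    + exact (filterlim_comp _ _ _ f cos _ _ _ (Hf t It)
               (continuous_cos (f t))).
    + exact (filterlim_comp _ _ _ f sin _ _ _ (Hf t It)
               (continuous_sin (f t))).
  - destruct (IH (Ck_on_weaken I k f Hf)) as [Hc Hs].
    destruct Hf as [f' [Hf Hf']].
    split.
    + exists (fun t => - sin (f t) * f' t); split.
      * intros t It; apply is_derive_on_comp; auto; apply is_derive_cos.
      * apply Ck_on_mult; [apply Ck_on_opp |]; assumption.
    + exists (fun t => cos (f t) * f' t); split.
      * intros t It; apply is_derive_on_comp; auto; apply is_derive_sin.
      * now apply Ck_on_mult.
Qed.

(** * Vector-valued functions *)

Definition Ck_on3 (I : R -> Prop) (k : nat) (f : R -> R3) : Prop :=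
  Ck_on I k (fun t => cx (f t)) /\
  Ck_on I k (fun t => cy (f t)) /\
  Ck_on I k (fun t => cz (f t)).

Lemma R3_eq (x y : R3) : cx x = cx y -> cy x = cy y -> cz x = cz y -> x = y.
Proof.
  destruct x as [[x1 x2] x3], y as [[y1 y2] y3].
  unfold cx, cy, cz; simpl; congruence.
Qed.

(** Closes an equation between reals that is an algebraic identity in the
    coordinates of the vectors involved. *)
Ltac coords_ring :=
  unfold dot, cx, cy, cz; simpl;
  unfold plus, minus, opp, scal; simpl;
  unfold plus, opp, scal, mult; simpl;
  unfold mult; simpl; ring.

Lemma smooth_on3_Ck (I : R -> Prop) (f : R -> R3) (k : nat) :
  is_interval I -> smooth_on3 I f -> Ck_on3 I k f.
Proof.
  intros hI [H1 [H2 H3]]; repeat split; now apply smooth_on_Ck.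
Qed.

Lemma Ck_on3_weaken (I : R -> Prop) (k : nat) (f : R -> R3) :
  Ck_on3 I (S k) f -> Ck_on3 I k f.
Proof.
  intros [H1 [H2 H3]]; repeat split; now apply Ck_on_weaken.
Qed.

Lemma Ck_on3_Derive_on3 (I : R -> Prop) (k : nat) (f : R -> R3) :
  is_interval I -> Ck_on3 I (S k) f -> Ck_on3 I k (Derive_on3 I f).
Proof.
  intros hI [H1 [H2 H3]]; repeat split; now apply Ck_on_Derive_on.
Qed.

Lemma Ck_on3_plus (I : R -> Prop) (k : nat) (f g : R -> R3) :
  Ck_on3 I k f -> Ck_on3 I k g -> Ck_on3 I k (fun t => plus (f t) (g t)).
Proof.
  intros [F1 [F2 F3]] [G1 [G2 G3]]; repeat split.
  - exact (Ck_on_plus I k _ _ F1 G1).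
  - exact (Ck_on_plus I k _ _ F2 G2).
  - exact (Ck_on_plus I k _ _ F3 G3).
Qed.

Lemma Ck_on3_minus (I : R -> Prop) (k : nat) (f g : R -> R3) :
  Ck_on3 I k f -> Ck_on3 I k g -> Ck_on3 I k (fun t => minus (f t) (g t)).
Proof.
  intros [F1 [F2 F3]] [G1 [G2 G3]]; repeat split.
  - exact (Ck_on_minus I k _ _ F1 G1).
  - exact (Ck_on_minus I k _ _ F2 G2).
  - exact (Ck_on_minus I k _ _ F3 G3).
Qed.

Lemma Ck_on3_scal (I : R -> Prop) (k : nat) (a : R -> R) (f : R -> R3) :
  Ck_on I k a -> Ck_on3 I k f -> Ck_on3 I k (fun t => scal (a t) (f t)).
Proof.
  intros A [F1 [F2 F3]]; repeat split.
  - exact (Ck_on_mult I k _ _ A F1).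
  - exact (Ck_on_mult I k _ _ A F2).
  - exact (Ck_on_mult I k _ _ A F3).
Qed.

Lemma Ck_on_dot (I : R -> Prop) (k : nat) (f g : R -> R3) :
  Ck_on3 I k f -> Ck_on3 I k g -> Ck_on I k (fun t => dot (f t) (g t)).
Proof.
  intros [F1 [F2 F3]] [G1 [G2 G3]].
  repeat apply Ck_on_plus; now apply Ck_on_mult.
Qed.

Lemma Ck_on3_cross (I : R -> Prop) (k : nat) (f g : R -> R3) :
  Ck_on3 I k f -> Ck_on3 I k g -> Ck_on3 I k (fun t => cross (f t) (g t)).
Proof.
  intros [F1 [F2 F3]] [G1 [G2 G3]].
  repeat split; apply Ck_on_minus; now apply Ck_on_mult.
Qed.

Lemma Derive_on_sub_mult (I : R -> Prop) (f a g : R -> R) (t : R) :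
  is_interval I -> I t -> Ck_on I 1 f -> Ck_on I 1 a -> Ck_on I 1 g ->
  Derive_on I (fun s => f s - a s * g s) t =
  Derive_on I f t - (Derive_on I a t * g t + a t * Derive_on I g t).
Proof.
  intros hI It Hf Ha Hg.
  pose proof (Derive_on_correct I 0 f t hI Hf It) as Df.
  pose proof (Derive_on_correct I 0 a t hI Ha It) as Da.
  pose proof (Derive_on_correct I 0 g t hI Hg It) as Dg.
  apply Derive_on_eq; [exact hI | exact It |].
  apply is_derive_on_plus; [exact Df |].
  apply is_derive_on_opp; now apply is_derive_on_mult.
Qed.

Lemma Derive_on3_sub_scal (I : R -> Prop) (f g : R -> R3) (a : R -> R)
    (t : R) :
  is_interval I -> I t -> Ck_on3 I 1 f -> Ck_on I 1 a -> Ck_on3 I 1 g ->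
  Derive_on3 I (fun s => minus (f s) (scal (a s) (g s))) t =
  minus (Derive_on3 I f t)
        (plus (scal (Derive_on I a t) (g t)) (scal (a t) (Derive_on3 I g t))).
Proof.
  intros hI It [F1 [F2 F3]] Ha [G1 [G2 G3]].
  apply R3_eq.
  - exact (Derive_on_sub_mult I _ a _ t hI It F1 Ha G1).
  - exact (Derive_on_sub_mult I _ a _ t hI It F2 Ha G2).
  - exact (Derive_on_sub_mult I _ a _ t hI It F3 Ha G3).
Qed.

(** Differentiate [v . v = 1]. *)
Lemma dot_Derive_on3_unit (I : R -> Prop) (v : R -> R3) (t : R) :
  is_interval I -> I t -> Ck_on3 I 1 v -> (forall s, I s -> S2 (v s)) ->
  dot (Derive_on3 I v t) (v t) = 0.
Proof.
  intros hI It [V1 [V2 V3]] unit.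
  pose proof (Derive_on_correct I 0 _ t hI V1 It) as D1.
  pose proof (Derive_on_correct I 0 _ t hI V2 It) as D2.
  pose proof (Derive_on_correct I 0 _ t hI V3 It) as D3.
  assert (C : is_derive_on I (fun s => dot (v s) (v s)) t 0).
  { apply (is_derive_on_ext I (fun _ => 1)); [exact It | |].
    - intros s Is; symmetry; exact (unit s Is).
    - apply is_derive_on_const. }
  pose proof (is_derive_on_unique I _ t _ _ hI It
    (is_derive_on_plus _ _ _ _ _ _
      (is_derive_on_plus _ _ _ _ _ _
        (is_derive_on_mult _ _ _ _ _ _ It D1 D1)
        (is_derive_on_mult _ _ _ _ _ _ It D2 D2))
      (is_derive_on_mult _ _ _ _ _ _ It D3 D3)) C) as H.
  unfold dot, Derive_on3; simpl; unfold cx, cy, cz in *; simpl in *; lra.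
Qed.

(** * Rotating an orthonormal pair *)

Definition rot1 (a : R) (x y : R3) : R3 :=
  minus (scal (cos a) x) (scal (sin a) y).
Definition rot2 (a : R) (x y : R3) : R3 :=
  plus (scal (sin a) x) (scal (cos a) y).

Lemma cross_rot (a : R) (x y : R3) :
  cross (rot1 a x y) (rot2 a x y) = cross x y.
Proof.
  pose proof (sin2_cos2 a) as T; unfold Rsqr in T.
  apply R3_eq;
    match goal with |- _ = ?r =>
      transitivity ((sin a * sin a + cos a * cos a) * r);
        [unfold rot1, rot2, cross; coords_ring | rewrite T; ring]
    end.
Qed.

Lemma Delta_rot (a : R) (x y : R3) :
  Defs.Delta x y -> Defs.Delta (rot1 a x y) (rot2 a x y).
Proof.
  pose proof (sin2_cos2 a) as T; unfold Rsqr in T.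
  unfold Defs.Delta, S2; intros [H1 [H2 H3]].
  repeat split.
  - transitivity (cos a * cos a * dot x x - 2 * cos a * sin a * dot x y +
                  sin a * sin a * dot y y); [unfold rot1; coords_ring |].
    rewrite H1, H2, H3; lra.
  - transitivity (sin a * sin a * dot x x + 2 * cos a * sin a * dot x y +
                  cos a * cos a * dot y y); [unfold rot2; coords_ring |].
    rewrite H1, H2, H3; lra.
  - transitivity (cos a * sin a * (dot x x - dot y y) +
                  (cos a * cos a - sin a * sin a) * dot x y);
      [unfold rot1, rot2; coords_ring |].
    rewrite H1, H2, H3; ring.
Qed.

(** The triple product identity [w x (v x w) = (w . w) v - (v . w) w]. *)
Lemma cross_cross_orthonormal (v w : R3) :
  Defs.Delta v w -> cross w (cross v w) = v.
Proof.
  unfold Defs.Delta, S2; intros [_ [H2 H3]].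
  transitivity (minus (scal (dot w w) v) (scal (dot v w) w)).
  - apply R3_eq; unfold cross; coords_ring.
  - rewrite H2, H3; apply R3_eq; coords_ring.
Qed.

(** * The evolute of a Bishop frame *)

(** Part of what makes [(gamma, v, w)] a framed curve again.  The last equation
    holds because [v] is a combination of [nu1] and [nu2]. *)
Lemma bishop_framed (I : R -> Prop) (F : framed_map) (theta : R -> R) :
  framed_curve I F -> forall t, I t ->
  Defs.Delta (nu1 (bishop F theta) t) (nu2 (bishop F theta) t) /\
  dot (Derive_on3 I (gamma F) t) (nu1 (bishop F theta) t) = 0.
Proof.
  intros [_ [_ [_ hF]]] t It.
  destruct (hF t It) as [HD [H1 H2]].
  split; [exact (Delta_rot (theta t) _ _ HD) |].
  transitivity (cos (theta t) * dot (Derive_on3 I (gamma F) t) (nu1 F t) -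
                sin (theta t) * dot (Derive_on3 I (gamma F) t) (nu2 F t)).
  - coords_ring.
  - rewrite H1, H2; ring.
Qed.

Lemma bishop_Ck (I : R -> Prop) (F : framed_map) (theta : R -> R) (k : nat) :
  is_interval I -> framed_curve I F -> smooth_on I theta ->
  Ck_on3 I k (gamma F) /\ Ck_on3 I k (nu1 (bishop F theta)) /\
  Ck_on3 I k (nu2 (bishop F theta)).
Proof.
  intros hI [hg [h1 [h2 _]]] hth.
  destruct (Ck_on_cos_sin I k theta (smooth_on_Ck I theta k hI hth))
    as [Hc Hs].
  pose proof (smooth_on3_Ck I _ k hI h1) as H1.
  pose proof (smooth_on3_Ck I _ k hI h2) as H2.
  split; [exact (smooth_on3_Ck I _ k hI hg) | split].
  - apply Ck_on3_minus; now apply Ck_on3_scal.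
  - apply Ck_on3_plus; now apply Ck_on3_scal.
Qed.

(** The function [alpha / m], by which the evolute is displaced along [v]. *)
Definition evolute_offset (I : R -> Prop) (B : framed_map) (t : R) : R :=
  curv_alpha I B t / curv_m I B t.

(** The curvature costs one derivative, hence [S k] in the hypotheses. *)
Lemma evolute_offset_Ck (I : R -> Prop) (B : framed_map) (k : nat) :
  is_interval I -> Ck_on3 I (S k) (gamma B) -> Ck_on3 I (S k) (nu1 B) ->
  Ck_on3 I (S k) (nu2 B) -> (forall t, I t -> curv_m I B t <> 0) ->
  Ck_on I k (evolute_offset I B).
Proof.
  intros hI Hg H1 H2 hm.
  assert (Hmu : Ck_on3 I k (mu B))
    by (apply Ck_on3_cross; now apply Ck_on3_weaken).
  apply Ck_on_mult.
  - apply Ck_on_dot; [now apply Ck_on3_Derive_on3 | exact Hmu].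
  - apply (Ck_on_inv I k (curv_m I B)); [exact hm |].
    apply Ck_on_dot; [now apply Ck_on3_Derive_on3 | exact Hmu].
Qed.

(** [v_E] and [w_E] are [w] and [mu] turned in their plane, so
    [v_E x w_E = w x mu]. *)
Lemma mu_evolute (I : R -> Prop) (B : framed_map) (thetaE : R -> R) (t : R) :
  Defs.Delta (nu1 B t) (nu2 B t) -> mu (v_evolute I B thetaE) t = nu1 B t.
Proof.
  intros HD.
  transitivity (cross (nu2 B t) (mu B t)).
  - exact (cross_rot (thetaE t) (nu2 B t) (mu B t)).
  - now apply cross_cross_orthonormal.
Qed.

(** Of the three terms of [E' . v = (gamma' - g' v - g v') . v], with
    [g = alpha / m], only the middle one survives. *)
Lemma evolute_alpha (I : R -> Prop) (B : framed_map) (thetaE : R -> R)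
    (t : R) :
  is_interval I -> I t ->
  Ck_on3 I 1 (gamma B) -> Ck_on3 I 1 (nu1 B) ->
  Ck_on I 1 (evolute_offset I B) ->
  (forall s, I s -> Defs.Delta (nu1 B s) (nu2 B s)) ->
  dot (Derive_on3 I (gamma B) t) (nu1 B t) = 0 ->
  curv_alpha I (v_evolute I B thetaE) t = - Derive_on I (evolute_offset I B) t.
Proof.
  intros hI It Hg Hv Ho HD orth.
  pose proof (dot_Derive_on3_unit I (nu1 B) t hI It Hv
                (fun s Is => proj1 (HD s Is))) as dv.
  pose proof (proj1 (HD t It)) as unit; unfold S2 in unit.
  unfold curv_alpha; rewrite (mu_evolute I B thetaE t (HD t It)).
  change (gamma (v_evolute I B thetaE)) with
    (fun s => minus (gamma B s) (scal (evolute_offset I B s) (nu1 B s))).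
  rewrite (Derive_on3_sub_scal I (gamma B) (nu1 B)) by assumption.
  set (g := evolute_offset I B t); set (g' := Derive_on I _ t).
  transitivity (dot (Derive_on3 I (gamma B) t) (nu1 B t) -
                g' * dot (nu1 B t) (nu1 B t) -
                g * dot (Derive_on3 I (nu1 B) t) (nu1 B t)).
  - coords_ring.
  - rewrite orth, unit, dv; ring.
Qed.

Theorem proposition4p2 (I : R -> Prop) (F : framed_map)
    (theta thetaE : R -> R) (t0 : R)
    (hI : is_interval I)
    (hF : framed_curve I F)
    (htheta : bishop_angle I F theta)
    (hm : forall t, I t -> curv_m I (bishop F theta) t <> 0)
    (hthetaE : evolute_angle I (bishop F theta) thetaE)
    (ht0 : I t0) :
  let B := bishop F theta in
  let c := curv_alpha I B t0 / curv_m I B t0 in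
  let lambda := - (curv_alpha I B t0 / curv_m I B t0) in
  forall t, I t ->
    involute I (v_evolute I B thetaE) t0 t
      = minus (gamma B t) (scal c (nu1 B t)) /\
    minus (gamma B t) (scal c (nu1 B t)) = v_parallel B lambda t.
Proof.
  intros B c lambda t It.
  pose proof (bishop_framed I F theta hF) as HB; fold B in HB.
  destruct (bishop_Ck I F theta 2 hI hF (proj1 htheta)) as [Cg [Cv Cw]].
  pose proof (evolute_offset_Ck I B 1 hI Cg Cv Cw hm) as Co.
  assert (HA : forall s, I s -> curv_alpha I (v_evolute I B thetaE) s =
                                - Derive_on I (evolute_offset I B) s).
  { intros s Is; apply evolute_alpha; try assumption.
    - now apply Ck_on3_weaken.
    - now apply Ck_on3_weaken.
    - intros r Ir; exact (proj1 (HB r Ir)).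
    - exact (proj2 (HB s Is)). }
  assert (HI : RInt (curv_alpha I (v_evolute I B thetaE)) t0 t =
               - evolute_offset I B t - - c).
  { apply (RInt_derive_on I (fun s => - evolute_offset I B s));
      [exact hI | | | exact ht0 | exact It].
    - intros s Is; rewrite (HA s Is).
      apply is_derive_on_opp, (Derive_on_correct I 0); assumption.
    - apply (Ck_on_ext I 0 (fun s => - Derive_on I (evolute_offset I B) s)).
      + intros s Is; symmetry; exact (HA s Is).
      + apply (Ck_on_opp I 0), (Ck_on_Derive_on I 0); assumption. }
  split.
  - unfold involute.
    rewrite HI, (mu_evolute I B thetaE t (proj1 (HB t It))).
    change (gamma (v_evolute I B thetaE) t) with
      (minus (gamma B t) (scal (evolute_offset I B t) (nu1 B t))).
    apply R3_eq; coords_ring.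
  - unfold v_parallel, lambda; fold c.
    apply R3_eq; coords_ring.
Qed.
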